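(* Let $\mathcal{B}$ be a structured basis for $\mathbb{R}^d$. Let $0<p<\infty$ and suppose the matrix weight $W:\mathbb{R}^d\to\mathbb{C}^{N\times N}$ is in $\mathbf{A}_p(\mathcal{B})$. Then there is a constant $C:=C(p)$ such that (i) for any $x\in\mathbb{C}^N\setminus\{0\}$, the scalar weight $w_x(t):=|W^{1/p}(t)x|^p$ is in $A_p(\mathcal{B})$ and $[w_x]_{A_p(\mathcal{B})}\le C\,[W]_{\mathbf{A}_p(\mathcal{B})}$, provided $1<p<\infty$; (ii) for any $x\in\mathbb{C}^N\setminus\{0\}$, the scalar weight $w_x(t):=|W^{1/p}(t)x|^p$ is in $A_1(\mathcal{B})$ and $[w_x]_{A_1(\mathcal{B})}\le[W]_{\mathbf{A}_p(\mathcal{B})}$, provided $0<p\le1$.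
   Context: A basis for $\mathbb{R}^d$ is any collection $\mathcal{B}$ of measurable, bounded subsets of $\mathbb{R}^d$ with non-empty interior. A structured basis is a basis for which there is a sequence $E_j\in\mathcal{B}$, $j\in\mathbb{N}$, with $E_j\subseteq E_{j+1}$ and $\bigcup_j\mathring{E}_j=\mathbb{R}^d$. Write $\fint_E f:=|E|^{-1}\int_E f$. Scalar weights: for a measurable weight $w:\mathbb{R}^d\to(0,\infty)$, put $[w]_{A_p(\mathcal{B})}:=\sup_{E\in\mathcal{B}}\fint_Ew(x)\,dx\cdot\big[\fint_Ew^{-1/(p-1)}(x)\,dx\big]^{p-1}$ for $1<p<\infty$ and $[w]_{A_1(\mathcal{B})}:=\sup_{E\in\mathcal{B}}\fint_Ew(x)\,dx\cdot\operatorname{ess\,sup}_{x\in E}w^{-1}(x)$; $w\in A_p(\mathcal{B})$ means $[w]_{A_p(\mathcal{B})}<\infty$. Matrix weights: a matrix weight is a measurable function $W:\mathbb{R}^d\to\mathbb{C}^{N\times N}$ that is strictly positive definite almost everywhere; real powers are taken in the sense of the functional calculus. $|\cdot|$ is the Euclidean norm on $\mathbb{C}^N$ and $\|\cdot\|$ is any matrix norm on the $N\times N$ matrices. For $0<p\le1$, $$[W]_{\mathbf{A}_p(\mathcal{B})}:=\sup_{E\in\mathcal{B}}\operatorname*{ess\,sup}_{t\in E}\fint_E\|W^{1/p}(x)W^{-1/p}(t)\|^p\,dx,$$ and for $1<p<\infty$, $1/p+1/p'=1$, $$[W]_{\mathbf{A}_p(\mathcal{B})}:=\sup_{E\in\mathcal{B}}\Big[\fint_E\Big(\fint_E\|W^{1/p}(x)W^{-1/p}(t)\|^{p'}dt\Big)^{p/p'}dx\Big]^{1/p}.$$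 $W\in\mathbf{A}_p(\mathcal{B})$ means $[W]_{\mathbf{A}_p(\mathcal{B})}<\infty$.
   Formalization: In (i) a C depending only on p is impossible with the outer power 1/p; here C may depend on W with C ≤ c[W]^{p-1}, c depending on p, N and the matrix norm only. In (ii) the norm is assumed to satisfy |Av| ≤ ‖A‖|v|, since constant 1 fails for arbitrary matrix norms. *)

(* Defs.v *)
From HB Require Import structures.
From mathcomp Require Import all_boot all_order all_algebra.
From mathcomp Require Import all_classical all_reals all_analysis.
From mathcomp.real_closed Require Import complex.

Set Implicit Arguments.
Unset Strict Implicit.
Unset Printing Implicit Defensive.

Import Order.TTheory GRing.Theory Num.Theory.
Import numFieldNormedType.Exports.

Local Open Scope classical_set_scope.
Local Open Scope ring_scope.

(* R^d is 'rV[R]_d.+1, so that only dimensions at least 1 occur. *)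

Section lebesgue_outer_measure.
Context {R : realType} (d : nat).
Local Notation V := 'rV[R]_d.+1.
Implicit Types (b : V * V) (A : set V).

Definition closed_box b : set V :=
  [set x | forall i, b.1 ord0 i <= x ord0 i <= b.2 ord0 i].

Definition box_nonempty b := forall i, b.1 ord0 i <= b.2 ord0 i.

Definition box_volume b : R := \prod_(i < d.+1) (b.2 ord0 i - b.1 ord0 i).

Definition box_cover A : set ((V * V) ^nat) :=
  [set b | (forall k, box_nonempty (b k)) /\
           A `<=` \bigcup_k closed_box (b k)].

Definition lebesgue_outer A : \bar R :=
  ereal_inf [set (\sum_(0 <= k <oo) (box_volume (b k))%:E)%E
            | b in box_cover A].

Lemma box_volume_ge0 b : box_nonempty b -> 0 <= box_volume b.
Proof. by move=> b0; apply: prodr_ge0 => i _; rewrite subr_ge0. Qed.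

Lemma lebesgue_outer_ge0 A : (0 <= lebesgue_outer A)%E.
Proof.
apply: le_ereal_inf_tmp => x [b [b0 _] <-{x}].
by apply: nneseries_ge0 => k _ _; rewrite lee_fin box_volume_ge0.
Qed.

Lemma lebesgue_outer0 : lebesgue_outer set0 = 0%E.
Proof.
apply/eqP; rewrite eq_le lebesgue_outer_ge0 andbT.
apply: ereal_inf_lbound; exists (fun=> (0, 0)).
  by split => [k i|]; [rewrite /= lexx|exact: sub0set].
apply: eseries0 => k _ _ /=.
by rewrite /box_volume (bigD1 ord0)//= subrr mul0r.
Qed.

Lemma le_lebesgue_outer :
  {homo lebesgue_outer : A B / A `<=` B >-> (A <= B)%E}.
Proof.
move=> A B AB; apply: ereal_inf_le_tmp => x [b [b0 Bb] <-{x}].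
by exists b => //; split => //; exact: subset_trans Bb.
Qed.

Lemma lebesgue_outer_sigma_subadditive : sigma_subadditive lebesgue_outer.
Proof.
move=> A; have [[i ioo]|] := pselect (exists i, lebesgue_outer (A i) = +oo%E).
  rewrite (eseries_pinfty _ _ ioo) ?leey// => n _.
  by rewrite -ltNye (lt_le_trans _ (lebesgue_outer_ge0 _)).
rewrite -forallNE => Aoo.
apply/lee_addgt0Pr => _/posnumP[e].
rewrite (le_trans _ (epsilon_trick _ _ _))//; last first.
  by move=> n; exact: lebesgue_outer_ge0.
pose P n (b : (V * V)^nat) := box_cover (A n) b /\
  (\sum_(0 <= k <oo) (box_volume (b k))%:E <=
   lebesgue_outer (A n) + (e%:num / (2 ^ n.+1)%:R)%:E)%E.
have [G PG] : {G : ((V * V)^nat)^nat & forall n, P n (G n)}.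
  apply: (@choice _ _ P) => n; rewrite /P.
  have Afin : lebesgue_outer (A n) \is a fin_num.
    by rewrite ge0_fin_numE ?lebesgue_outer_ge0// ltey; apply/eqP/Aoo.
  have en1 : 0 < e%:num / (2 ^ n.+1)%:R by [].
  have [x [b Ab <-] /ltW xS] := lb_ereal_inf_adherent en1 Afin.
  by exists b.
pose vol (z : nat * nat) : \bar R := (box_volume (G z.1 z.2))%:E.
have vol_ge0 z : (0 <= vol z)%E.
  by rewrite lee_fin box_volume_ge0//; exact: (PG z.1).1.1.
apply: (@le_trans _ _ (\esum_(z in setT) vol z)%E).
  apply: ereal_inf_lbound => /=.
  have /card_esym/ppcard_eqP[f] := card_nat2.
  exists (fun k => G (f k).1 (f k).2).
    split => [k|]; first exact: (PG _).1.1.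
    move=> t [n _ /(PG n).1.2 [k _ tk]].
    by exists (f^-1%FUN (n, k)) => //; rewrite invK ?inE.
  rewrite [LHS](_ : _ = \sum_(0 <= k <oo) vol (f k))%E//.
  rewrite -(esum_pred_image vol f xpredT) ?[fun=> _]set_true//.
  by rewrite image_eq.
rewrite (_ : esum _ _ = \sum_(0 <= i <oo) \sum_(0 <= j <oo) vol (i, j))%E; last first.
  pose J : nat -> set (nat * nat) := fun i => [set (i, j) | j in setT].
  rewrite (_ : setT = \bigcup_k J k); last first.
    by rewrite predeqE => -[a b]; split => // _; exists a => //; exists b.
  rewrite esum_bigcupT /=; last 2 first.
    - apply/trivIsetP => i j _ _ ij.
      rewrite predeqE => -[n m] /=; split => //= -[] [_] _ [<-{n} _].
      by move=> [m' _] [] /esym/eqP; rewrite (negbTE ij).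
    - by move=> z; exact: vol_ge0.
  rewrite -(image_id [set: nat]) -fun_true esum_pred_image//; last first.
    by move=> n _; exact: esum_ge0.
  apply: eq_eseriesr => /= j _.
  rewrite -(esum_pred_image vol (pair j) predT)//=; last first.
    by move=> ? ? _ _; exact: (@can_inj _ _ _ snd).
  by congr esum; rewrite predeqE => -[a b]; split; move=> [i _ <-]; exists i.
apply: lee_nneseries => [i _ _|i _]; last exact: (PG i).2.
by apply: nneseries_ge0 => j _ _; exact: vol_ge0.
Qed.

HB.instance Definition _ := isOuterMeasure.Build R V lebesgue_outer
  lebesgue_outer0 lebesgue_outer_ge0 le_lebesgue_outer
  lebesgue_outer_sigma_subadditive.

End lebesgue_outer_measure.

(* 'rV[R]_d.+1 with its complete sigma-algebra of Lebesgue measurable sets. *)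
Notation Rd R d := (caratheodory_type (@lebesgue_outer R d)).

Definition lebesgue (R : realType) (d : nat) : set (Rd R d) -> \bar R :=
  @lebesgue_outer R d.

HB.instance Definition _ (R : realType) (d : nat) :=
  isMeasure.Build _ _ _ (@lebesgue R d)
    (@caratheodory_measure0 _ _ (@lebesgue_outer R d))
    (@caratheodory_measure_ge0 _ _ (@lebesgue_outer R d))
    (@caratheodory_measure_sigma_additive _ _ (@lebesgue_outer R d)).

Section averages.
Context {R : realType} {d : nat}.
Local Open Scope ereal_scope.
Implicit Types (E : set (Rd R d)) (f : Rd R d -> \bar R).

Definition fint E f : \bar R :=
  (fine (lebesgue E))^-1%:E * \int[@lebesgue R d]_(x in E) f x.

(* ess_sup on a subset E; ess_sup in the library is over the whole space. *)
Definition ess_sup_in E f : \bar R :=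
  ereal_inf [set y | {ae @lebesgue R d, forall t, E t -> f t <= y}].

End averages.

Section bases.
Context {R : realType} {d : nat}.
Implicit Type B : set (set (Rd R d)).

Definition basis B := forall E, B E ->
  [/\ measurable E, bounded_set (E : set 'rV[R]_d.+1)
    & (E : set 'rV[R]_d.+1)° !=set0].

Definition structured_basis B := basis B /\
  exists F : (set (Rd R d))^nat,
    [/\ forall j, B (F j), forall j, F j `<=` F j.+1
      & \bigcup_j (F j : set 'rV[R]_d.+1)° = setT].

End bases.

Section scalar_weights.
Context {R : realType} {d : nat}.
Local Open Scope ereal_scope.
Implicit Types (B : set (set (Rd R d))) (w : Rd R d -> R).

(* Weights are determined up to null sets: positivity is required a.e. *)
Definition scalar_weight w :=
  measurable_fun setT w /\ {ae @lebesgue R d, forall t, (0 < w t)%R}.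

(* Meaningful for 1 <= p. *)
Definition scalar_Ap_const (p : R) B w : \bar R :=
  if p == 1%R then
    ereal_sup [set fint E (fun x => (w x)%:E) *
                   ess_sup_in E (fun x => (w x)^-1%:E) | E in B]
  else
    ereal_sup [set fint E (fun x => (w x)%:E) *
      (fint E (fun x => (w x `^ (- (p - 1)^-1))%:E)) `^ (p - 1) | E in B].

Definition scalar_Ap (p : R) B w :=
  scalar_weight w /\ scalar_Ap_const p B w < +oo.

End scalar_weights.

Section complex_matrices.
Context {R : realType} {N : nat}.
Local Notation C := R[i].
Local Open Scope sesquilinear_scope.
Implicit Types (A : 'M[C]_N) (v : 'cV[C]_N).

Definition euclid_norm v : R := Num.sqrt (\sum_i (Normc.normc (v i 0)) ^+ 2).

(* Over R[i], 0 < z means that z is a positive real number. *)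
Definition posdefmx A := A \is hermsymmx /\
  forall v, v != 0 -> 0 < (v^t* *m A *m v) 0 0.

(* Functional calculus for z |-> z ^ r; meaningful for posdefmx A, whose
   spectral_diag is real and positive. *)
Definition mxpowR A (r : R) : 'M[C]_N :=
  invmx (spectralmx A)
  *m diag_mx (map_mx (fun z : C => (complex.Re z `^ r)%:C%C) (spectral_diag A))
  *m spectralmx A.

Record matrix_norm (nrm : 'M[C]_N -> R) : Prop := MatrixNorm {
  matrix_norm_eq0 : forall A, nrm A = 0 -> A = 0;
  matrix_normZ : forall (a : C) A, nrm (a *: A) = Normc.normc a * nrm A;
  matrix_normD : forall A1 A2, nrm (A1 + A2) <= nrm A1 + nrm A2 }.

Definition euclid_compatible (nrm : 'M[C]_N -> R) :=
  forall A v, euclid_norm (A *m v) <= nrm A * euclid_norm v.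

End complex_matrices.

Section matrix_weights.
Context {R : realType} {d N : nat}.
Local Notation C := R[i].
Local Open Scope ereal_scope.
Implicit Types (B : set (set (Rd R d))) (W : Rd R d -> 'M[C]_N)
  (nrm : 'M[C]_N -> R).

Definition matrix_weight W :=
  (forall i j, measurable_fun setT (fun t => complex.Re (W t i j)) /\
               measurable_fun setT (fun t => complex.Im (W t i j))) /\
  {ae @lebesgue R d, forall t, posdefmx (W t)}.

Definition matrix_Ap_const nrm (p : R) B W : \bar R :=
  let K x t := nrm (mxpowR (W x) p^-1 *m mxpowR (W t) (- p^-1)) in
  if (p <= 1)%R then
    ereal_sup [set ess_sup_in E (fun t => fint E (fun x => (K x t `^ p)%:E))
              | E in B]
  else
    let p' := (p / (p - 1))%R in
    ereal_sup [set
      (fint E (fun x => (fint E (fun t => (K x t `^ p')%:E)) `^ (p / p')))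
        `^ p^-1 | E in B].

Definition matrix_Ap nrm (p : R) B W :=
  matrix_weight W /\ matrix_Ap_const nrm p B W < +oo.

Definition directional_weight (p : R) W (x : 'cV[C]_N) : Rd R d -> R :=
  fun t => (euclid_norm (mxpowR (W t) p^-1 *m x) `^ p)%R.

End matrix_weights.

(* Main.v *)
Require Import Defs.
From mathcomp Require Import all_boot all_order all_algebra.
From mathcomp Require Import all_classical all_reals all_analysis.
From mathcomp Require Import measurable_realfun.
From mathcomp Require Import ring lra.
From mathcomp.real_closed Require Import complex.

Set Implicit Arguments.
Unset Strict Implicit.
Unset Printing Implicit Defensive.

Import Order.TTheory GRing.Theory Num.Theory.
Import numFieldNormedType.Exports.

Local Open Scope classical_set_scope.
Local Open Scope ring_scope.

(** The heart of the matter is a pointwise comparison.  Write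
    l t = |W t ^ (1/p) x|, so that the directional weight is w = l ^ p, and
    K s t = ||W s ^ (1/p) W t ^ (-1/p)||.  Inserting
    W t ^ (-1/p) W t ^ (1/p) = 1 in front of x gives l s <= c K s t l t
    whenever W t is positive definite, where c compares the chosen matrix norm
    with the operator norm ([ae_euclid_norm_le_kernel],
    [euclid_norm_mulmx_le]).

    For 1 < p, divide by c * l t, raise to the power p' = p / (p - 1) and
    average over t; then raise to the power p - 1 = p / p' and average over s.
    The left-hand side becomes the scalar A_p product of w on E, up to the
    factor c ^ p, and the right-hand side is at most the p-th power of the
    matrix constant ([fint_mul_dual_le_kernel]).  Hence C is c ^ p times the
    (p - 1)-th power of the matrix constant.  For p <= 1, raising to the power
    p, averaging over s and taking the essential supremum over t gives the
    bound at once, with c = 1 when the norm dominates the Euclidean operator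
    norm ([fint_mul_ess_sup_le_kernel]).  The kernel K only occurs in the larger
    function of each comparison of averages, and the integral of nonnegative
    functions is monotone as soon as the smaller one is measurable
    ([ae_le_ge0_integral]); so it is the measurability of w that remains.

    Measurability of w is the delicate point, because the spectral
    decomposition behind W t ^ (1/p) depends on t through a choice.  But
    l t ^ 2 = \sum_i lam_i ^ (2/p) c_i for the eigenvalues lam_i of W t and the
    squared coordinates c_i of x in an eigenbasis, and the same sums with
    natural exponents k are x^* (W t)^k x, which are polynomials in the entries
    of W t.  Bernstein polynomials, applied to the eigenvalues divided by the
    trace, exhibit l t ^ 2 as a pointwise limit of combinations of such moments
    ([moments_powR_cvg], [directional_weight_measurable]).

    Sets of measure zero or infinite measure have zero averages and are
    harmless, except that for p <= 1 the matrix constant has to be nonnegative,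
    which requires one set of positive measure in the basis.  This holds as the
    basis contains a covering of the space, and the unit cube is not null
    ([lebesgue_outer_cube_ge1], [structured_basis_nonnull]). *)

(** * Bernstein polynomials *)

Section bernstein.
Context {R : realType}.
Implicit Types (f g : nat -> R) (x : R) (n : nat).

(** The polynomial \sum_k 'C(n, k) f k 'X^k (1 - 'X)^(n - k), by conditioning
    on the first of n Bernoulli trials: in this form positivity and the variance
    identity are immediate inductions. *)
Fixpoint bernstein n f : {poly R} :=
  if n is m.+1 then 'X * bernstein m (f \o S) + (1 - 'X) * bernstein m f
  else (f 0%N)%:P.

Let bernsteinS n f x : (bernstein n.+1 f).[x] =
  x * (bernstein n (f \o S)).[x] + (1 - x) * (bernstein n f).[x].
Proof. by rewrite /= !hornerE. Qed.

Lemma le_bernstein n f g x : 0 <= x <= 1 ->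
  (forall k, (k <= n)%N -> f k <= g k) ->
  (bernstein n f).[x] <= (bernstein n g).[x].
Proof.
move=> /andP[x0 x1]; elim: n f g => [|n IH] f g fg.
  by rewrite /= !hornerE fg.
rewrite !bernsteinS lerD// ler_wpM2l ?subr_ge0//; apply: IH => k kn.
  exact: fg.
by apply: fg; exact: leqW.
Qed.

Lemma bernstein_affine n f x a b c :
  (bernstein n (fun k => a + b * f k + c)).[x] =
  a + b * (bernstein n f).[x] + c.
Proof.
elim: n f => [|n IH] f; first by rewrite /= !hornerE.
by rewrite !bernsteinS IH; rewrite (IH (f \o S)); ring.
Qed.

(** The second moment about a of the number of successes in n trials: squared
    bias plus variance. *)
Lemma bernstein_variance n x a :
  (bernstein n (fun k => (k%:R - a) ^+ 2)).[x] =
  (n%:R * x - a) ^+ 2 + n%:R * (x * (1 - x)).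
Proof.
elim: n a => [|n IH] a; first by rewrite /= !hornerE /=; ring.
rewrite bernsteinS IH.
have -> : ((fun k : nat => (k%:R - a) ^+ 2) \o S) =
          (fun k : nat => (k%:R - (a - 1)) ^+ 2 : R).
  by apply/funext => k /=; rewrite -natr1; ring.
by rewrite IH -natr1; ring.
Qed.

(** Chebyshev's argument: outside the neighbourhood of x where g is within e / 2
    of g x, the error 2 M is dominated by a multiple of the squared deviation,
    whose mean is O(1 / n) by [bernstein_variance]. *)
Lemma bernstein_cvg (g : R -> R) M x : 0 <= x <= 1 ->
  (forall y, 0 <= y <= 1 -> `|g y| <= M) -> {for x, continuous g} ->
  (bernstein n (fun k => g (k%:R / n%:R))).[x] @[n --> \oo] --> g x.
Proof.
move=> x01 gM gx; apply/cvgrPdist_le => e e0.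
have M0 : 0 <= M by apply: le_trans (gM x x01).
have e20 : 0 < e / 2 by rewrite divr_gt0.
move/cvgrPdist_le : gx => /(_ _ e20) /nbhs_ballP[d /= d0 gd].
near=> n.
have n0 : (0 : R) < n%:R by rewrite ltr0n; near: n; exact: nbhs_infty_gt.
pose b := 2 * M / d ^+ 2 / n%:R ^+ 2.
have b0 : 0 <= b by rewrite !divr_ge0 ?mulr_ge0 ?exprn_ge0// ltW.
pose V k : R := (k%:R - n%:R * x) ^+ 2.
have key k : (k <= n)%N -> `|g x - g (k%:R / n%:R)| <= e / 2 + b * V k.
  move=> kn; have [dk|kd] := ltP `|x - k%:R / n%:R| d.
    by rewrite (le_trans (gd _ dk))// lerDl mulr_ge0 ?sqr_ge0.
  have -> : V k = n%:R ^+ 2 * `|x - k%:R / n%:R| ^+ 2.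
    rewrite real_normK ?num_real// -exprMn /V -sqrrN; congr (_ ^+ 2).
    by field; rewrite gt_eqF.
  have -> : b * (n%:R ^+ 2 * `|x - k%:R / n%:R| ^+ 2) =
            2 * M * (`|x - k%:R / n%:R| / d) ^+ 2.
    by rewrite /b; field; rewrite !gt_eqF.
  apply: (@le_trans _ _ (2 * M)).
    have -> : 2 * M = M + M by ring.
    rewrite (le_trans (ler_normB _ _))// lerD ?gM//.
    by rewrite divr_ge0//= ler_pdivrMr// mul1r ler_nat.
  rewrite -[leLHS]add0r lerD ?(ltW e20)// ler_peMr ?mulr_ge0//.
  by rewrite exprn_ege1// ler_pdivlMr// mul1r.
have bV : b * (n%:R * (x * (1 - x))) <= e / 2.
  have -> : b * (n%:R * (x * (1 - x))) = 2 * M / d ^+ 2 * (x * (1 - x)) / n%:R.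
    by rewrite /b; field; rewrite !gt_eqF.
  rewrite ler_pdivrMr// -ler_pdivrMl//.
  by near: n; exact: nbhs_infty_ger.
have V_E : (bernstein n V).[x] = n%:R * (x * (1 - x)).
  by rewrite bernstein_variance subrr expr0n/= add0r.
rewrite ler_distlC; apply/andP; split.
- apply: (@le_trans _ _ (bernstein n (fun k => g x + (- b) * V k + - (e / 2))).[x]).
    by rewrite bernstein_affine V_E mulNr; lra.
  by apply: le_bernstein => // k /key; rewrite ler_distlC => /andP[+ _]; lra.
- apply: (@le_trans _ _ (bernstein n (fun k => g x + b * V k + e / 2)).[x]).
    by apply: le_bernstein => // k /key; rewrite ler_distlC => /andP[_]; lra.
  by rewrite bernstein_affine V_E; lra.
Unshelve. all: by end_near. Qed.

End bernstein.

(** * Comparison of norms *)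

Section norm_equivalence.
Context {R : realType}.

(** A norm is continuous for the sup norm, hence attains a positive minimum on
    the compact unit sphere. *)
Lemma rV_norm_le_equiv n (g : 'rV[R]_n -> R) :
  (forall a v, g (a *: v) = `|a| * g v) ->
  (forall u v, g (u + v) <= g u + g v) ->
  (forall v, g v = 0 -> v = 0) ->
  exists2 c, 0 < c & forall v, `|v| <= c * g v.
Proof.
move=> gZ gD g_eq0.
have gN v : g (- v) = g v by rewrite -scaleN1r gZ normrN1 mul1r.
have g0 : g 0 = 0 by rewrite -(scale0r 0) gZ normr0 mul0r.
have g_ge0 v : 0 <= g v.
  by have := gD v (- v); rewrite subrr gN g0; lra.
have g_sum (I : Type) (r : seq I) (F : I -> 'rV[R]_n) :
    g (\sum_(i <- r) F i) <= \sum_(i <- r) g (F i).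
  elim/big_rec2: _ => [|i x y _ xy]; first by rewrite g0.
  by rewrite (le_trans (gD _ _))// lerD2l.
have coord_le (v : 'rV[R]_n) j : `|v ord0 j| <= `|v|.
  by rewrite [leRHS]mx_normrE; apply/bigmax_geP; right => /=; exists (ord0, j).
pose K := \sum_(j < n) g (delta_mx 0 j).
have K0 : 0 <= K by exact: sumr_ge0.
have gK v : g v <= K * `|v|.
  rewrite {1}(row_sum_delta v) (le_trans (g_sum _ _ _))// mulr_suml.
  by apply: ler_sum => j _; rewrite gZ mulrC ler_wpM2l.
have g_cont : continuous g.
  move=> v; apply/(@cvgrPdist_le _ _ _ (nbhs v)) => e e0; apply/nbhs_ballP.
  have K1 : 0 < K + 1 by exact: ltr_wpDl.
  exists ((K + 1)^-1 * e); first by rewrite /= mulr_gt0// invr_gt0.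
  move=> u; rewrite -ball_normE /= => /ltW; rewrite ler_pdivlMl// => uv.
  have dist : `|g v - g u| <= K * `|v - u|.
    rewrite (le_trans _ (gK _))// ler_norml lerBlDr.
    have := gD (v - u) u; have := gD (u - v) v.
    rewrite !subrK -[u - v]opprB gN => h1 h2; apply/andP; split; lra.
  by rewrite (le_trans dist)// (le_trans _ uv)// ler_wpM2r// lerDl.
pose S := [set v : 'rV[R]_n | `|v| = 1].
have [S0|/set0P S0] := eqVneq S set0.
  exists 1 => // v; rewrite mul1r.
  have [->|v0] := eqVneq v 0; first by rewrite normr0.
  have : S (`|v|^-1 *: v) by rewrite /S/= normrZ normfV normr_id mulVf ?normr_eq0.
  by rewrite S0.
have S_compact : compact S.
  apply: bounded_closed_compact.
    by exists 1; split => // y y1 v /= ->; exact: ltW.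
  rewrite (_ : S = (fun v => `|v|) @^-1` [set 1 : R]); last by [].
  apply: (@preimage_closed 'rV[R]_n R (fun v : 'rV[R]_n => `|v|)).
    by move=> v _; exact: norm_continuous.
  exact: closed_eq.
have [|v0 Sv0 min_v0] := @EVT_min_rV R n g S S0 S_compact.
  exact: continuous_subspaceT.
rewrite inE in Sv0.
have gv0 : 0 < g v0.
  rewrite lt_neqAle g_ge0 andbT eq_sym; apply/eqP => /g_eq0 v00.
  by move: Sv0; rewrite /S/= v00 normr0 => /eqP; rewrite eq_sym oner_eq0.
exists (g v0)^-1; first by rewrite invr_gt0.
move=> v; have [->|vn0] := eqVneq v 0; first by rewrite normr0 g0 mulr0.
have nv0 : 0 < `|v| by rewrite normr_gt0.
rewrite ler_pdivlMl//.
have /min_v0 : `|v|^-1 *: v \in S.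
  by rewrite inE /S/= normrZ normfV normr_id mulVf ?gt_eqF.
by rewrite gZ normfV normr_id ler_pdivlMl// mulrC.
Qed.

End norm_equivalence.

Section euclid_norm.
Context {R : realType} {N : nat}.
Local Notation C := R[i].
Implicit Types (A : 'M[C]_N) (v : 'cV[C]_N) (z : C).

Lemma normc_ge0 z : 0 <= Normc.normc z.
Proof. by case: z => a b; exact: sqrtr_ge0. Qed.

Lemma normc_sum (I : Type) (r : seq I) (F : I -> C) :
  Normc.normc (\sum_(i <- r) F i) <= \sum_(i <- r) Normc.normc (F i).
Proof.
elim/big_rec2: _ => [|i x y _ xy]; first by rewrite Normc.normc0.
by rewrite (le_trans (le_normcD _ _))// lerD2l.
Qed.

Lemma normc_le_ReIm z : Normc.normc z <= `|complex.Re z| + `|complex.Im z|.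
Proof.
case: z => a b /=; rewrite -[leRHS]ger0_norm ?addr_ge0// -sqrtr_sqr.
rewrite ler_wsqrtr// -[a ^+ 2]real_normK ?num_real// -[b ^+ 2]real_normK ?num_real//.
by rewrite sqrrD lerD2r lerDl mulrn_wge0 ?mulr_ge0.
Qed.

Lemma normc_realC (a : R) : Normc.normc a%:C%C = `|a|.
Proof. by rewrite /= expr0n/= addr0 sqrtr_sqr. Qed.

Lemma euclid_norm_ge0 v : 0 <= euclid_norm v.
Proof. exact: sqrtr_ge0. Qed.

Lemma normc_le_euclid_norm v i : Normc.normc (v i 0) <= euclid_norm v.
Proof.
rewrite -[leLHS](ger0_norm (normc_ge0 _)) -sqrtr_sqr ler_wsqrtr//.
by rewrite (bigD1 i)//= lerDl sumr_ge0// => j _; exact: sqr_ge0.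
Qed.

Lemma euclid_norm_le_sum v : euclid_norm v <= \sum_i Normc.normc (v i 0).
Proof.
have sum_ge0 : 0 <= \sum_i Normc.normc (v i 0).
  by apply: sumr_ge0 => i _; exact: normc_ge0.
rewrite -[leRHS]ger0_norm// -sqrtr_sqr ler_wsqrtr// {sum_ge0}.
suff : 0 <= \sum_i Normc.normc (v i 0) /\
    \sum_i Normc.normc (v i 0) ^+ 2 <= (\sum_i Normc.normc (v i 0)) ^+ 2 by case.
elim/big_rec2: _ => [|i x y _ [y0 xy]]; first by rewrite expr0n/=.
have ? := normc_ge0 (v i 0); split; first exact: addr_ge0.
by rewrite sqrrD -addrA lerD2l (le_trans xy)// lerDr mulrn_wge0 ?mulr_ge0.
Qed.

Variable nrm : 'M[C]_N -> R.
Hypothesis nrmP : matrix_norm nrm.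

Lemma matrix_norm_ge0 A : 0 <= nrm A.
Proof.
have [_ nrmZ nrmD] := nrmP.
have := nrmD A (- A); rewrite subrr.
have -> : nrm 0 = 0 by rewrite -(scale0r 0) nrmZ Normc.normc0 mul0r.
have -> : nrm (- A) = nrm A.
  by rewrite -scaleN1r nrmZ normcN Normc.normc1 mul1r.
lra.
Qed.

(** A complex matrix is encoded as the real row vector of the real and imaginary
    parts of its entries, to which [rV_norm_le_equiv] applies. *)
Lemma normc_entry_le_matrix_norm :
  exists2 c, 0 < c & forall A i j, Normc.normc (A i j) <= c * nrm A.
Proof.
have [nrm_eq0 nrmZ nrmD] := nrmP.
pose T (v : 'rV[R]_(N * N + N * N)) : 'M[C]_N :=
  vec_mx (\row_k (lsubmx v 0 k +i* rsubmx v 0 k)%C).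
pose S (A : 'M[C]_N) : 'rV[R]_(N * N + N * N) :=
  row_mx (\row_k complex.Re (mxvec A 0 k)) (\row_k complex.Im (mxvec A 0 k)).
have TK A : T (S A) = A.
  rewrite /T -[RHS]mxvecK; congr vec_mx; apply/rowP => k.
  by rewrite row_mxKl row_mxKr !mxE; case: (mxvec A 0 k).
have TD (u v : 'rV[R]_(N * N + N * N)) : T (u + v) = T u + T v.
  by rewrite -linearD; congr vec_mx; apply/rowP => k; rewrite !mxE.
have TZ a (v : 'rV[R]_(N * N + N * N)) : T (a *: v) = a%:C%C *: T v.
  rewrite -linearZ; congr vec_mx; apply/rowP => k; rewrite !mxE.
  by apply/eqP; rewrite eq_complex /= !mul0r subr0 addr0 !eqxx.
have T_eq0 (v : 'rV[R]_(N * N + N * N)) : T v = 0 -> v = 0.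
  move=> /(congr1 mxvec); rewrite vec_mxK linear0 => /rowP Tv0.
  rewrite -[v]hsubmxK -[RHS]row_mx0; congr row_mx; apply/rowP => k.
    by have := Tv0 k; rewrite !mxE => -[].
  by have := Tv0 k; rewrite !mxE => -[].
have [|u v|v|c c0 gc] := @rV_norm_le_equiv R _ (nrm \o T).
- by move=> a v /=; rewrite TZ nrmZ normc_realC.
- by rewrite /= TD nrmD.
- by move=> /= /nrm_eq0/T_eq0.
exists (2 * c); first by rewrite mulr_gt0.
move=> A i j; rewrite (le_trans (normc_le_ReIm _))//.
have coord k : `|S A ord0 k| <= c * nrm A.
  rewrite -[in leRHS](TK A) (le_trans _ (gc _))// [leRHS]mx_normrE.
  by apply/bigmax_geP; right => /=; exists (ord0, k).
have := coord (lshift _ (mxvec_index i j)).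
have := coord (rshift _ (mxvec_index i j)).
rewrite row_mxEl row_mxEr !mxE !mxvecE => h1 h2.
by rewrite -mulrA mulr_natl mulr2n lerD.
Qed.

Lemma euclid_norm_mulmx_le :
  exists2 c, 0 < c &
    forall A v, euclid_norm (A *m v) <= c * nrm A * euclid_norm v.
Proof.
have [c c0 entry] := normc_entry_le_matrix_norm.
(* The summand 1 keeps the constant positive when N = 0. *)
exists (N%:R * N%:R * c + 1); first by rewrite ltr_wpDl// !mulr_ge0// ltW.
move=> A v; rewrite (le_trans (euclid_norm_le_sum _))//.
have nA := matrix_norm_ge0 A; have nv := euclid_norm_ge0 v.
apply: (@le_trans _ _ (\sum_(i < N) \sum_(j < N) (c * nrm A * euclid_norm v))).
  apply: ler_sum => i _; rewrite mxE (le_trans (normc_sum _ _))//.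
  apply: ler_sum => j _; rewrite Normc.normcM ler_pM ?normc_ge0//.
  exact: normc_le_euclid_norm.
rewrite !sumr_const !card_ord -mulrnA -[leLHS]mulr_natl natrM !mulrA.
by rewrite ler_wpM2r// ler_wpM2r// lerDl.
Qed.

End euclid_norm.

(** * The unit cube has positive measure *)

Section cube.
Context {R : realType}.
Local Open Scope ereal_scope.

(** Boxes that cover the unit cube have total volume at least 1.  Induction on
    the dimension, with multiplicities c k so that the induction applies to a
    slice of the cube: the slice at height y selects the boxes whose first side
    contains y, and integrating over y in [0, 1] restores the missing side. *)
Lemma cube_cover_volume n (c : R^nat) (a b : nat -> 'I_n -> R) :
  (forall k, (0 <= c k)%R) -> (forall k i, (a k i <= b k i)%R) ->
  (forall x : 'I_n -> R, (forall i, (0 <= x i <= 1)%R) ->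
    1 <= \sum_(0 <= k <oo) (c k * \prod_(i < n) \1_(`[a k i, b k i]) (x i))%:E) ->
  1 <= \sum_(0 <= k <oo) (c k * \prod_(i < n) (b k i - a k i))%:E.
Proof.
elim: n c a b => [|n IH] c a b c0 ab cover.
  have := cover (fun=> 0%R); rewrite lexx ler01 => /(_ (fun=> isT)).
  under eq_eseriesr do rewrite big_ord0.
  by under [in X in _ -> X]eq_eseriesr do rewrite big_ord0.
pose v k := (\prod_(i < n) (b k (lift ord0 i) - a k (lift ord0 i)))%R.
have v0 k : (0 <= v k)%R by apply: prodr_ge0 => i _; rewrite subr_ge0.
pose I k := `[a k ord0, b k ord0]%classic : set R.
have slice y : (0 <= y <= 1)%R ->
    1 <= \sum_(0 <= k <oo) ((c k * v k) * \1_(I k) y)%:E.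
  move=> y01.
  have := IH (fun k => c k * \1_(I k) y)%R (fun k i => a k (lift ord0 i))
             (fun k i => b k (lift ord0 i)).
  under [in X in _ -> _ -> _ -> X]eq_eseriesr do rewrite mulrAC.
  apply; [by move=> k; rewrite mulr_ge0|by move=> k i; exact: ab|].
  move=> x x01.
  pose x' i := if unlift ord0 i is Some j then x j else y.
  have x'01 i : (0 <= x' i <= 1)%R by rewrite /x'; case: unlift.
  have := cover _ x'01; congr (_ <= _); apply: eq_eseriesr => k _.
  rewrite big_ord_recl mulrA {1}/x' unlift_none; congr (_ * _)%:E.
  by apply: eq_bigr => i _; rewrite /x' liftK.
pose J := `[0%R, 1%R]%classic : set R.
have mI k : measurable (I k).
  exact: measurable_itv.
have mJ : measurable J.
  exact: measurable_itv.
have mI1 k : measurable_fun J (fun y : R => (\1_(I k) y)%:E : \bar R).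
  by apply/measurable_EFinP.
have mf k : measurable_fun J (fun y : R => ((c k * v k) * \1_(I k) y)%:E : \bar R).
  apply/measurable_EFinP; apply: measurable_funM => //.
have f0 k y : J y -> 0 <= ((c k * v k) * \1_(I k) y)%:E.
  by move=> _; rewrite lee_fin !mulr_ge0.
have : 1 <= \int[lebesgue_measure]_(y in J)
              \sum_(0 <= k <oo) ((c k * v k) * \1_(I k) y)%:E.
  apply: (@le_trans _ _ (\int[lebesgue_measure]_(y in J) (cst 1%:E y))).
    have muJ : lebesgue_measure J = 1.
      by rewrite /J lebesgue_measure_itv/= lte_fin ltr01 oppr0 adde0.
    rewrite integral_cst//.
    by rewrite mul1e [leRHS]muJ.
  apply: ge0_le_integral => //.
  by apply: (@ge0_emeasurable_sum _ _ _ J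
    (fun k y => ((c k * v k) * \1_(I k) y)%:E) xpredT) => [k y Jy _|k _];
    [exact: f0|exact: mf].
rewrite integral_nneseries// => /le_trans; apply.
apply: lee_nneseries => [k _ _|k _]; first by apply: integral_ge0 => y; exact: f0.
under eq_integral do rewrite EFinM.
rewrite ge0_integralZl_EFin//; last 2 first.
- exact: mI1.
- by rewrite mulr_ge0.
rewrite integral_indic//; last exact: measurable_itv.
rewrite big_ord_recl mulrCA -/(v k) muleC.
rewrite [leRHS]EFinM lee_wpmul2r ?lee_fin ?mulr_ge0//.
apply: (@le_trans _ _ (lebesgue_measure (I k))).
  by apply: le_measure => //; rewrite inE; [apply: measurableI|];
    exact: measurable_itv.
by rewrite lebesgue_measure_itv/=; case: ifP => // _; rewrite lee_fin subr_ge0.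
Qed.

Lemma lebesgue_outer_cube_ge1 d :
  1 <= lebesgue_outer [set x : 'rV[R]_d.+1 | forall i, (0 <= x ord0 i <= 1)%R].
Proof.
apply: le_ereal_inf_tmp => _ [b [b0 bcover] <-].
have := @cube_cover_volume d.+1 (fun=> 1%R) (fun k i => (b k).1 ord0 i)
  (fun k i => (b k).2 ord0 i).
under [X in _ -> _ -> _ -> 1 <= X]eq_eseriesr do rewrite mul1r.
apply; [by []|exact: b0|move=> x x01].
have [|k _ xk] := bcover (\row_i x i); first by move=> i; rewrite mxE.
rewrite (le_trans _ (nneseries_lim_ge k.+1 _))//; last first.
  by move=> j _ _; rewrite mul1r lee_fin prodr_ge0.
have prod1 :
  (\prod_(i < d.+1) \1_(`[(b k).1 ord0 i, (b k).2 ord0 i]) (x i) = 1 :> R)%R.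
  apply: big1 => i _; rewrite indicE mem_set//= in_itv/=.
  by have := xk i; rewrite mxE.
rewrite big_nat_recr//= prod1.
rewrite mulr1 leeDr// sume_ge0// => j _.
by rewrite mul1r lee_fin prodr_ge0.
Qed.

End cube.

(** * Spectral calculus of positive definite matrices *)

Section spectral.
Context {R : realType} {N : nat}.
Local Notation C := R[i].
Local Open Scope sesquilinear_scope.
Implicit Types (A : 'M[C]_N) (v x : 'cV[C]_N) (z : C).

Lemma conjC_mul_normc z : z^* * z = ((Normc.normc z) ^+ 2)%:C%C.
Proof. by rewrite mulrC -normCK rmorphXn. Qed.

Lemma euclid_norm_sqr v : euclid_norm v ^+ 2 = \sum_i Normc.normc (v i 0) ^+ 2.
Proof. by rewrite sqr_sqrtr// sumr_ge0// => i _; exact: sqr_ge0. Qed.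

Lemma dotmx_euclid_norm v : (v^t* *m v) 0 0 = (euclid_norm v ^+ 2)%:C%C.
Proof.
rewrite euclid_norm_sqr rmorph_sum/= mxE; apply: eq_bigr => i _.
by rewrite !mxE conjC_mul_normc.
Qed.

Lemma unitarymx_trC_mul (U : 'M[C]_N) : U \is unitarymx -> U^t* *m U = 1%:M.
Proof. by move=> Uu; rewrite -invmx_unitary// mulVmx ?unitarymx_unit. Qed.

Lemma unitarymx_dot (U : 'M[C]_N) v x : U \is unitarymx ->
  (U *m v)^t* *m (U *m x) = v^t* *m x.
Proof.
move=> Uu; rewrite trmx_mul map_mxM mulmxA -(mulmxA _ _ U).
by rewrite (unitarymx_trC_mul Uu) mulmx1.
Qed.

Lemma euclid_norm_unitarymx (U : 'M[C]_N) v : U \is unitarymx ->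
  euclid_norm (U *m v) = euclid_norm v.
Proof.
move=> Uu; apply/eqP; rewrite -(@eqrXn2 _ 2)// ?euclid_norm_ge0//; apply/eqP.
apply: complexI.
by rewrite -!dotmx_euclid_norm unitarymx_dot.
Qed.

Lemma euclid_norm_eq0 v : euclid_norm v = 0 -> v = 0.
Proof.
move=> v0; apply/colP => i; rewrite mxE; apply: Normc.eq0_normc.
apply/eqP; rewrite eq_le normc_ge0 andbT.
by rewrite (le_trans (normc_le_euclid_norm _ _))// v0.
Qed.

Definition eigenvalues A i : R := complex.Re (spectral_diag A 0 i).

Definition spectral_weight A x i : R :=
  Normc.normc ((spectralmx A *m x) i 0) ^+ 2.

Lemma posdefmx_spectral A : posdefmx A ->
  A = invmx (spectralmx A) *m diag_mx (spectral_diag A) *m spectralmx A.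
Proof. by move=> [Ah _]; exact/orthomx_spectralP/hermitian_normalmx. Qed.

(** The quadratic form at the i-th eigenvector is the i-th eigenvalue, and
    positivity of a complex number includes that it is real. *)
Lemma posdefmx_eigenvalues A i : posdefmx A ->
  0 < eigenvalues A i /\ spectral_diag A 0 i = (eigenvalues A i)%:C%C.
Proof.
move=> Apd; set U := spectralmx A.
have Uu : U \is unitarymx := spectral_unitarymx A.
have U1 : U \in unitmx := spectral_unit A.
pose e : 'cV[C]_N := delta_mx i 0; pose v := invmx U *m e.
have ve : U *m v = e by rewrite mulKVmx.
have v0 : v != 0.
  apply/eqP => v0; move: ve; rewrite v0 mulmx0 => /colP/(_ i)/eqP.
  by rewrite !mxE !eqxx eq_sym oner_eq0.
have [_ /(_ _ v0)] := Apd.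
have -> : v^t* *m A *m v = e^t* *m (diag_mx (spectral_diag A) *m e).
  rewrite {1}(posdefmx_spectral Apd) -/U -!mulmxA.
  rewrite ve.
  by rewrite -(unitarymx_dot v _ Uu) ve mulKVmx.
have -> : (e^t* *m (diag_mx (spectral_diag A) *m e)) 0 0 = spectral_diag A 0 i.
  rewrite mul_diag_mx mxE (bigD1 i)//= big1 ?addr0 => [|j ji].
    by rewrite !mxE !eqxx rmorph1 mul1r mulr1.
  by rewrite !mxE (negbTE ji) /= rmorph0 mul0r.
rewrite ltcE /eigenvalues => /andP[/eqP im0 re0]; split => //.
by move: im0; case: (spectral_diag A 0 i) => a b /= ->.
Qed.

Lemma mxpowRN_mul A r : posdefmx A -> mxpowR A (- r) *m mxpowR A r = 1%:M.
Proof.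
move=> Apd; rewrite /mxpowR -!mulmxA mulKVmx ?spectral_unit// [X in _ *m X]mulmxA.
rewrite mulmx_diag; set D := diag_mx _.
have -> : D = 1%:M.
  rewrite -diag_const_mx; congr diag_mx; apply/rowP => i; rewrite !mxE.
  have [l0 _] := posdefmx_eigenvalues i Apd.
  by rewrite -rmorphM /= powRN mulVf// gt_eqF// powR_gt0.
by rewrite mul1mx mulVmx ?spectral_unit.
Qed.

Lemma euclid_norm_mxpowR A r x :
  euclid_norm (mxpowR A r *m x) ^+ 2 =
  \sum_i (eigenvalues A i `^ r) ^+ 2 * spectral_weight A x i.
Proof.
have Uu := spectral_unitarymx A.
rewrite /mxpowR -!mulmxA euclid_norm_unitarymx; last first.
  by rewrite (invmx_unitary Uu) trmxC_unitary.
rewrite euclid_norm_sqr; apply: eq_bigr => i _.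
rewrite mul_diag_mx [X in _ = _ * X]/spectral_weight mxE mxE.
by rewrite Normc.normcM exprMn normc_realC real_normK ?num_real.
Qed.

Lemma euclid_norm_mxpowR_gt0 A r x : posdefmx A -> x != 0 ->
  0 < euclid_norm (mxpowR A r *m x).
Proof.
move=> Apd x0; rewrite lt_neqAle euclid_norm_ge0 andbT.
apply/eqP => /esym Arx0; have {}Arx0 := euclid_norm_eq0 Arx0.
move/eqP: x0; apply; rewrite -[x]mul1mx -(mxpowRN_mul r Apd).
move: (congr1 (mulmx (mxpowR A (- r))) Arx0).
by rewrite mulmxA (mulmx0 _ (mxpowR A (- r))).
Qed.

Lemma posdefmx_trace A : posdefmx A ->
  complex.Re (\tr A) = \sum_i eigenvalues A i.
Proof.
move=> Apd; rewrite {1}(posdefmx_spectral Apd) mxtrace_mulC mulmxA.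
rewrite mulmxV ?spectral_unit// mul1mx mxtrace_diag raddf_sum.
by [].
Qed.

(** Powers of A act diagonally in the eigenbasis, so the moments of the spectral
    measure of x are polynomial in the entries of A. *)
Lemma posdefmx_moment A x k : posdefmx A ->
  complex.Re ((x^t* *m iter k (mulmx A) x) 0 0) =
  \sum_i eigenvalues A i ^+ k * spectral_weight A x i.
Proof.
move=> Apd; set U := spectralmx A.
have Uu : U \is unitarymx := spectral_unitarymx A.
have Uv i : (U *m iter k (mulmx A) x) i 0 =
    (eigenvalues A i ^+ k)%:C%C * (U *m x) i 0.
  elim: k => [|k IH] /=; first by rewrite mul1r.
  rewrite {1}(posdefmx_spectral Apd) -!mulmxA mulKVmx ?spectral_unit//.
  rewrite mul_diag_mx mxE IH; have [_ ->] := posdefmx_eigenvalues i Apd.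
  by rewrite mulrA -rmorphM -exprS.
rewrite -(unitarymx_dot _ _ Uu) mxE raddf_sum; apply: eq_bigr => i _.
have -> : (U *m x)^t* 0 i = ((U *m x) i 0)^* by rewrite !mxE.
by rewrite Uv mulrCA conjC_mul_normc -rmorphM.
Qed.

End spectral.

(** * Measurability of directional weights *)

Section powR_moments.
Context {R : realType}.

Definition bernstein_powR (s : R) n : {poly R} :=
  bernstein n (fun k => (k%:R / n%:R) `^ s).

Lemma bernstein_powR_cvg (s x : R) : 0 <= s -> 0 < x <= 1 ->
  (bernstein_powR s n).[x] @[n --> \oo] --> x `^ s.
Proof.
move=> s0 /andP[x0 x1].
apply: (@bernstein_cvg _ (fun y => y `^ s) 1); first by rewrite ltW.
  move=> y /andP[y0 y1]; rewrite ger0_norm ?powR_ge0//.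
  suff : y `^ s <= 1 `^ s by rewrite powR1.
  by apply: ge0_ler_powR; rewrite ?nnegrE.
apply: differentiable_continuous; apply/derivable1_diffP.
by apply: derivable_powR; rewrite in_itv/= andbT.
Qed.

(** Real moments from natural ones.  The scaling by M puts all the nodes l i in
    ]0, 1], where the Bernstein polynomials of y |-> y `^ s converge; the
    approximants involve the nodes only through their sum and their moments. *)
Lemma moments_powR_cvg m (l c : 'I_m -> R) (s : R) : 0 <= s ->
  (forall i, 0 < l i) ->
  let M := \sum_i l i in
  M `^ s * (\sum_(k < size (bernstein_powR s n))
    (bernstein_powR s n)`_k * ((M `^ (-1)) ^+ k * \sum_i l i ^+ k * c i))
    @[n --> \oo] --> \sum_i l i `^ s * c i.
Proof.
move=> s0 l0 M.
have lM i : l i <= M by rewrite /M (bigD1 i)//= lerDl sumr_ge0// => j _; exact: ltW.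
have M0 (i : 'I_m) : 0 < M := lt_le_trans (l0 i) (lM i).
have -> : \sum_i l i `^ s * c i = M `^ s * \sum_i ((l i / M) `^ s * c i).
  rewrite mulr_sumr; apply: eq_bigr => i _; rewrite mulrA -powRM.
  - by rewrite mulrCA divff ?mulr1// gt_eqF// (M0 i).
  - by rewrite ltW// (M0 i).
  - by rewrite divr_ge0// ltW// (M0 i).
apply: cvgMr.
rewrite (_ : (fun n => _) =
    (fun n => \sum_i ((bernstein_powR s n).[l i / M] * c i))); last first.
  apply/funext => n; rewrite [RHS](eq_bigr (fun i => \sum_(k < size (bernstein_powR s n))
      (bernstein_powR s n)`_k * ((M `^ (-1)) ^+ k * (l i ^+ k * c i)))) => [|i _].
    rewrite exchange_big/=; apply: eq_bigr => k _.
    by rewrite !mulr_sumr.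
  rewrite horner_coef mulr_suml; apply: eq_bigr => k _.
  rewrite powR_inv1 ?exprMn; last by rewrite sumr_ge0// => j _; exact: ltW.
  by ring.
apply: cvg_big => [|i _]; first exact: add_continuous.
apply: cvgMl.
apply: bernstein_powR_cvg => //.
by rewrite divr_gt0 ?(M0 i)//= ler_pdivrMr ?(M0 i)// mul1r.
Qed.

End powR_moments.

Section measurability.
Context {R : realType} {d : measure_display} {T : measurableType d}.
Local Notation C := R[i].
Implicit Types f g : T -> C.

Definition cmeasurable f :=
  measurable_fun setT (fun t => complex.Re (f t)) /\
  measurable_fun setT (fun t => complex.Im (f t)).

Lemma cmeasurable_cst z : cmeasurable (fun=> z).
Proof. by split; exact: measurable_cst. Qed.

Lemma cmeasurableM f g : cmeasurable f -> cmeasurable g ->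
  cmeasurable (fun t => f t * g t).
Proof.
move=> [mf1 mf2] [mg1 mg2]; split.
  rewrite (_ : (fun t => _) = (fun t => complex.Re (f t) * complex.Re (g t) -
      complex.Im (f t) * complex.Im (g t))); last first.
    by apply/funext => t; case: (f t) (g t) => a b [].
  by apply: measurable_funB; exact: measurable_funM.
rewrite (_ : (fun t => _) = (fun t => complex.Re (f t) * complex.Im (g t) +
    complex.Im (f t) * complex.Re (g t))); last first.
  by apply/funext => t; case: (f t) (g t) => a b [].
by apply: measurable_funD; exact: measurable_funM.
Qed.

Lemma cmeasurable_sum m (F : 'I_m -> T -> C) : (forall i, cmeasurable (F i)) ->
  cmeasurable (fun t => \sum_i F i t).
Proof.
move=> mF; split; under eq_fun do rewrite raddf_sum;
  by apply: measurable_sum => i; case: (mF i).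
Qed.

End measurability.

Section directional_weight_measurable.
Context {R : realType} {d N : nat}.
Local Notation C := R[i].
Local Notation mu := (@lebesgue R d).
Variables (p : R) (W : Rd R d -> 'M[C]_N) (x : 'cV[C]_N).
Hypotheses (p_gt0 : 0 < p) (Wp : matrix_weight W).
Local Open Scope sesquilinear_scope.

Let W_cmeasurable i j : cmeasurable (fun t => W t i j).
Proof. by have [mW _] := Wp; exact: mW. Qed.

Let iter_cmeasurable k i : cmeasurable (fun t => iter k (mulmx (W t)) x i 0).
Proof.
elim: k i => [|k IH] i /=; first exact: cmeasurable_cst.
under eq_fun do rewrite mxE; apply: cmeasurable_sum => j.
by apply: cmeasurableM.
Qed.

Let moment_measurable k : measurable_fun setT
  (fun t => complex.Re ((x^t* *m iter k (mulmx (W t)) x) 0 0)).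
Proof.
have [] // : cmeasurable (fun t => (x^t* *m iter k (mulmx (W t)) x) 0 0).
under eq_fun do rewrite mxE; apply: cmeasurable_sum => j.
by apply: cmeasurableM => //; exact: cmeasurable_cst.
Qed.

Let trace_measurable : measurable_fun setT (fun t => complex.Re (\tr (W t))).
Proof.
have [] // : cmeasurable (fun t => \tr (W t)).
by apply: cmeasurable_sum => j.
Qed.

(** Off a null set, the squared length is the limit of functions built from the
    trace and the moments of W, which are measurable; completeness of the
    measure takes care of the null set. *)
Lemma directional_weight_measurable :
  measurable_fun setT (directional_weight p W x).
Proof.
have [_ [Z [mZ Z0 WZ]]] := Wp.
have posW t : (~` Z) t -> posdefmx (W t).
  by move=> Zt; apply: contrapT => nW; apply: Zt; exact: WZ.
pose s := 2 / p.
have s0 : 0 <= s by rewrite divr_ge0// ltW.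
pose S t := euclid_norm (mxpowR (W t) p^-1 *m x) ^+ 2.
pose h n t := (complex.Re (\tr (W t))) `^ s *
  (\sum_(k < size (@bernstein_powR R s n)) (bernstein_powR s n)`_k *
    ((complex.Re (\tr (W t)) `^ (-1)) ^+ k *
     complex.Re ((x^t* *m iter k (mulmx (W t)) x) 0 0))).
have mh n : measurable_fun setT (h n).
  apply: measurable_funM.
    exact: (measurableT_comp (measurable_powR s)).
  apply: measurable_sum => k.
  apply: measurable_funM; first exact: measurable_cst.
  apply: measurable_funM; last exact: moment_measurable.
  apply: measurable_funX.
  exact: (measurableT_comp (measurable_powR (-1))).
have mS : measurable_fun (~` Z) S.
  apply: (@measurable_fun_cvg _ _ _ _ h).
    by move=> n; apply: measurable_funS (mh n).
  move=> t /posW Wt; rewrite /S euclid_norm_mxpowR.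
  rewrite (_ : \sum_i _ =
    \sum_i eigenvalues (W t) i `^ s * spectral_weight (W t) x i); last first.
    apply: eq_bigr => i _; congr (_ * _).
    by rewrite -powR_mulrn ?powR_ge0// -powRrM [p^-1 * _]mulrC.
  rewrite (_ : h ^~ t = fun n => (\sum_i eigenvalues (W t) i) `^ s *
    (\sum_(k < size (@bernstein_powR R s n)) (bernstein_powR s n)`_k *
      (((\sum_i eigenvalues (W t) i) `^ (-1)) ^+ k *
       \sum_i eigenvalues (W t) i ^+ k * spectral_weight (W t) x i))); last first.
    apply/funext => n; rewrite /h (posdefmx_trace Wt); congr (_ * _).
    by apply: eq_bigr => k _; rewrite (posdefmx_moment _ _ Wt).
  apply: moments_powR_cvg => // i.
  by have [] := posdefmx_eigenvalues i Wt.
have mw : measurable_fun (~` Z) (directional_weight p W x).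
  rewrite (_ : directional_weight p W x = (fun t => S t `^ (p / 2))).
    apply: (measurable_comp measurableT _ (measurable_powR _)) => //.
  apply/funext => t; rewrite /directional_weight /S.
  rewrite -powR_mulrn ?euclid_norm_ge0// -powRrM; congr (_ `^ _).
  by rewrite mulrCA divff ?mulr1.
apply/measurable_EFinP.
apply: (@ae_measurable_fun _ _ _ mu _ _
  (EFin \o (directional_weight p W x \_ (~` Z)))).
- exact: measure_is_complete_caratheodory.
- exists Z; split => // t /= ; apply: contra_notP => Zt _.
  by rewrite patchE mem_set.
- apply/measurable_EFinP.
  exact: (measurable_restrictT _ (measurableC mZ)).1 mw.
Qed.

End directional_weight_measurable.

(** * Monotone averages and null sets *)

Section integral_monotone.
Local Open Scope ereal_scope.
Context d (T : measurableType d) (R : realType).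
Variable mu : {measure set T -> \bar R}.
Implicit Types (D : set T) (f g : T -> \bar R).

(** The integral of a nonnegative function is a supremum over the simple
    functions below it, hence is monotone on arbitrary functions. *)
Lemma ge0_le_integral_subset D1 D2 f g : D1 `<=` D2 ->
  (forall x, D1 x -> 0 <= f x) -> (forall x, D2 x -> 0 <= g x) ->
  (forall x, D1 x -> f x <= g x) ->
  \int[mu]_(x in D1) f x <= \int[mu]_(x in D2) g x.
Proof.
move=> D12 f0 g0 fg; rewrite !ge0_integralE//.
apply: ge_ereal_sup => _ [h hf <-]; apply: ereal_sup_ubound.
exists h => // x; apply: (le_trans (hf x)).
rewrite !patchE; case: (boolP (x \in D1)) => [|_].
  by rewrite inE => Dx; rewrite mem_set ?fg//; exact: D12.
by case: (boolP (x \in D2)) => [|_]; rewrite ?lexx// inE => /g0.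
Qed.

Lemma ae_le_ge0_integral D f g : measurable D -> measurable_fun D f ->
  (forall x, D x -> 0 <= f x) -> (forall x, D x -> 0 <= g x) ->
  {ae mu, forall x, D x -> f x <= g x} ->
  \int[mu]_(x in D) f x <= \int[mu]_(x in D) g x.
Proof.
move=> mD mf f0 g0 [N [mN N0 fgN]].
rewrite (ge0_negligible_integral mN mD mf f0 N0).
apply: ge0_le_integral_subset => // [x [Dx _]|x [Dx Nx]].
  exact: f0.
apply: contra_notP Nx => nfg.
by apply: fgN => /= /(_ Dx).
Qed.

End integral_monotone.

Section averages.
Context {R : realType} {d : nat}.
Local Open Scope ereal_scope.
Local Notation mu := (@lebesgue R d).
Implicit Types (E : set (Rd R d)) (f g : Rd R d -> \bar R).

Lemma fint_ge0 E f : (forall x, E x -> 0 <= f x) -> 0 <= fint E f.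
Proof.
by move=> f0; rewrite mule_ge0 ?integral_ge0// lee_fin invr_ge0 fine_ge0.
Qed.

Lemma ae_le_fint E f g : measurable E -> measurable_fun E f ->
  (forall x, E x -> 0 <= f x) -> (forall x, E x -> 0 <= g x) ->
  {ae mu, forall x, E x -> f x <= g x} -> fint E f <= fint E g.
Proof.
move=> mE mf f0 g0 fg; rewrite lee_wpmul2l ?lee_fin ?invr_ge0 ?fine_ge0//.
exact: ae_le_ge0_integral.
Qed.

Lemma fintZl E f (k : \bar R) : measurable E -> measurable_fun E f ->
  (forall x, E x -> 0 <= f x) -> 0 <= k ->
  fint E (fun x => k * f x) = k * fint E f.
Proof. by move=> mE mf f0 k0; rewrite /fint ge0_integralZl// muleCA. Qed.

Lemma ae_nonnull_witness E (P : Rd R d -> Prop) : mu E != 0 ->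
  measurable E -> {ae mu, forall t, E t -> P t} -> exists2 t, E t & P t.
Proof.
move=> E0 mE [N [mN N0 PN]]; apply: contrapT => nP.
move/eqP: E0; apply; apply/eqP; rewrite -measure_le0 -N0 le_measure ?inE//.
move=> t Et; apply: PN => /= /(_ Et) Pt; apply: nP; exists t => //.
Qed.

Lemma ess_sup_in_ge0 E f : mu E != 0 -> measurable E ->
  (forall t, E t -> 0 <= f t) -> 0 <= ess_sup_in E f.
Proof.
move=> E0 mE f0; apply: le_ereal_inf_tmp => y /(ae_nonnull_witness E0 mE)[t Et].
exact: le_trans (f0 t Et).
Qed.

(** The interiors of countably many sets of the basis cover the space, so these
    sets cannot all be null. *)
Lemma structured_basis_nonnull (B : set (set (Rd R d))) : structured_basis B ->
  exists2 E, B E & mu E != 0.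
Proof.
move=> [basisB [F [BF _ Fcover]]]; apply: contrapT => nB.
have F0 j : lebesgue_outer (F j) = 0.
  apply/eqP; apply: contrapT => Fj; apply: nB.
  by exists (F j); [exact: BF|exact/negP].
have := @lebesgue_outer_cube_ge1 R d; apply/negP; rewrite -ltNge.
apply: (@le_lt_trans _ _ (lebesgue_outer (\bigcup_j F j))).
  apply: le_outer_measure => x _.
  have : setT x by [].
  by rewrite -Fcover => -[j _ /interior_subset Fjx]; exists j.
apply: le_lt_trans (outer_measure_sigma_subadditive _ _) _.
by rewrite eseries0 ?lte01// => j _ _; exact: F0.
Qed.

End averages.

(** * Weights dominated by a kernel *)

Section kernel_domination.
Context {R : realType} {d : nat}.
Local Notation mu := (@lebesgue R d).
Variables (p c : R) (l : Rd R d -> R) (K : Rd R d -> Rd R d -> R).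
Variable E : set (Rd R d).
Local Notation w := (fun t => l t `^ p).
Hypotheses (p_gt0 : 0 < p) (c_gt0 : 0 < c) (mE : measurable E).
Hypotheses (l_ge0 : forall t, 0 <= l t) (K_ge0 : forall s t, 0 <= K s t).
Hypothesis mw : measurable_fun setT w.
Hypothesis lK : {ae mu, forall t, 0 < l t /\ forall s, l s <= c * K s t * l t}.
Local Open Scope ereal_scope.

Let mEw : measurable_fun E (EFin \o w).
Proof. by apply/measurable_EFinP; exact: measurable_funS mw. Qed.

Let w_ge0 t : 0 <= (w t)%:E. Proof. by rewrite lee_fin powR_ge0. Qed.

(** With v = w `^ (- (p - 1)^-1) = l `^ (- p'), the hypothesis reads
    (l s / c) `^ p' * v t <= K s t `^ p'.  The constants stay on the left of all
    inequalities under the averages, where every function is measurable. *)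
Lemma fint_mul_dual_le_kernel (p' := (p / (p - 1))%R) : (1 < p)%R ->
  fint E (fun t => (w t)%:E) *
    fint E (fun t => (w t `^ (- (p - 1)^-1))%:E) `^ (p - 1) <=
  (c `^ p)%:E *
    fint E (fun s => fint E (fun t => (K s t `^ p')%:E) `^ (p / p')).
Proof.
move=> p1; set b := fint E (fun t => (w t `^ _)%:E).
set a := fint E (fun t => (w t)%:E).
have p10 : (0 < p - 1)%R by rewrite subr_gt0.
have p'0 : (0 < p')%R by rewrite divr_gt0.
have -> : (p / p' = p - 1)%R by rewrite /p'; field; rewrite !gt_eqF.
pose I s := fint E (fun t => (K s t `^ p')%:E).
set J := fint E (fun s => I s `^ (p - 1)).
have I0 s : 0 <= I s by apply: fint_ge0 => t _; rewrite lee_fin powR_ge0.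
have b0 : 0 <= b by apply: fint_ge0 => t _; rewrite lee_fin powR_ge0.
have mv : measurable_fun E (fun t => (w t `^ (- (p - 1)^-1))%:E).
  apply/measurable_EFinP; apply: measurable_funTS.
  exact: (measurableT_comp (measurable_powR _) mw).
have v0 t : 0 <= (w t `^ (- (p - 1)^-1))%:E by rewrite lee_fin powR_ge0.
have inner s : ((l s / c) `^ p')%:E * b <= I s.
  have ls0 : 0 <= ((l s / c) `^ p')%:E by rewrite lee_fin powR_ge0.
  rewrite -(fintZl mE mv (fun t _ => v0 t) ls0).
  apply: (ae_le_fint mE (measurable_funeM _ mv)) => [t _|t _|].
  - by rewrite mule_ge0.
  - by rewrite lee_fin powR_ge0.
  apply: filterS lK => t [lt0 lsK] _; rewrite -EFinM lee_fin.
  rewrite -powRrM mulrN -/p' powRN ler_pdivrMr ?powR_gt0//.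
  rewrite -powRM ?(ltW lt0)//.
  apply: ge0_ler_powR; rewrite ?(ltW p'0)// ?nnegrE.
  - by rewrite divr_ge0// ltW.
  - by rewrite mulr_ge0// ltW.
  - by rewrite ler_pdivrMr// mulrC mulrA lsK.
pose k := (c^-1 `^ p)%:E * b `^ (p - 1).
have k0 : 0 <= k by rewrite mule_ge0 ?lee_fin ?powR_ge0 ?poweR_ge0.
have outer : k * a <= J.
  rewrite -(fintZl mE mEw (fun t _ => w_ge0 t) k0).
  apply: (ae_le_fint mE (measurable_funeM _ mEw)) => [t _|t _|].
  - exact: mule_ge0 k0 (w_ge0 t).
  - exact: poweR_ge0.
  apply: aeW => s _ /=.
  have -> : k * (w s)%:E = (((l s / c) `^ p')%:E * b) `^ (p - 1).
    rewrite poweRM ?lee_fin ?powR_ge0// poweR_EFin -powRrM.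
    have -> : (p' * (p - 1) = p)%R by rewrite /p' divfK ?gt_eqF.
    rewrite powRM ?invr_ge0 ?(ltW c_gt0)// EFinM.
    by rewrite muleC muleA.
  have ls0 : 0 <= ((l s / c) `^ p')%:E by rewrite lee_fin powR_ge0.
  apply: (gt0_ler_poweR (ltW p10)); last exact: inner.
    by rewrite in_itv/= leey (mule_ge0 ls0 b0).
  by rewrite in_itv/= leey I0.
apply: (@le_trans _ _ ((c `^ p)%:E * (k * a))).
  have ck : (c `^ p)%:E * k = b `^ (p - 1).
    rewrite /k muleA -EFinM -powRM ?invr_ge0 ?(ltW c_gt0)//.
    by rewrite divff ?gt_eqF// powR1 mul1e.
  by rewrite [leRHS]muleA ck muleC.
by rewrite lee_wpmul2l// lee_fin powR_ge0.
Qed.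

Lemma fint_mul_ess_sup_le_kernel : mu E != 0 ->
  fint E (fun t => (w t)%:E) * ess_sup_in E (fun t => (w t)^-1%:E) <=
  (c `^ p)%:E * ess_sup_in E (fun t => fint E (fun s => (K s t `^ p)%:E)).
Proof.
move=> E0; set g := fun t => fint E (fun s => (K s t `^ p)%:E).
set a := fint E _.
have a0 : 0 <= a by exact: fint_ge0.
have g0 t : 0 <= g t by apply: fint_ge0 => s _; rewrite lee_fin powR_ge0.
have cp0 : (0 < c `^ p)%R by rewrite powR_gt0.
have ag : {ae mu, forall t, (0 < w t)%R /\ a * (w t)^-1%:E <= (c `^ p)%:E * g t}.
  apply: filterS lK => t [lt0 lsK]; have wt0 : (0 < w t)%R by rewrite powR_gt0.
  split=> //.
  pose k := ((c `^ p)^-1 * (w t)^-1)%:E.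
  have k0 : 0 <= k by rewrite lee_fin mulr_ge0// invr_ge0 ltW.
  have : k * a <= g t.
    rewrite -(fintZl mE mEw (fun s _ => w_ge0 s) k0).
    apply: (ae_le_fint mE (measurable_funeM _ mEw)) => [s _|s _|].
    - exact: mule_ge0 k0 (w_ge0 s).
    - by rewrite lee_fin powR_ge0.
    apply: aeW => s _ /=; rewrite -EFinM lee_fin -mulrA ler_pdivrMl// mulrC.
    rewrite ler_pdivrMr// -!powRM ?mulr_ge0// ?(ltW c_gt0)//.
    apply: ge0_ler_powR; rewrite ?nnegrE ?(ltW p_gt0)// ?mulr_ge0//.
    exact: ltW.
  by rewrite /k EFinM -muleA lee_pdivrMl// muleC.
(* It is enough to bound the product by c `^ p * y for every essential upper
   bound y of g; a point t of E where everything holds shows that the average a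
   of w is finite when y is. *)
rewrite -lee_pdivrMl//; apply: le_ereal_inf_tmp => y yE; rewrite lee_pdivrMl//.
have agy : {ae mu, forall t, E t ->
    [/\ (0 < w t)%R, a * (w t)^-1%:E <= (c `^ p)%:E * y & 0 <= y]}.
  apply: filterS2 ag yE => t [wt0 agt] /[apply] gty; split => //.
    by rewrite (le_trans agt)// lee_wpmul2l// lee_fin ltW.
  exact: le_trans (g0 t) gty.
have [t _ [wt0 ay y0]] := ae_nonnull_witness E0 mE agy.
case: y ay y0 yE agy => [y ay y0 _ agy|_ _ _ _|//]; last first.
  by rewrite mulry gtr0_sg// mul1e leey.
have afin : a \is a fin_num.
  rewrite ge0_fin_numE// ltey; apply/eqP => aoo; move: ay.
  by rewrite aoo mulyr gtr0_sg ?invr_gt0// mul1e.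
have [a00|an0] := eqVneq a 0.
  by rewrite a00 mul0e lee_fin mulr_ge0// ltW.
have fa0 : (0 < fine a)%R by rewrite fine_gt0// lt0e an0 a0 ltey_eq afin.
rewrite -[a]fineK// -lee_pdivlMl// -EFinM; apply: ereal_inf_lbound.
apply: filterS agy => u + Eu => /(_ Eu)[wu0 + _].
by rewrite -[a]fineK// -!EFinM !lee_fin ler_pdivlMl.
Qed.

End kernel_domination.

(** * The scalar constants of directional weights *)

Section directional_weights.
Context {R : realType} {d N : nat}.
Local Notation C := R[i].
Local Notation mu := (@lebesgue R d).
Variables (nrm : 'M[C]_N -> R) (p c : R).
Variables (W : Rd R d -> 'M[C]_N) (x : 'cV[C]_N).
Hypothesis nrm_ge : forall A v,
  euclid_norm (A *m v) <= c * nrm A * euclid_norm v.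
Hypotheses (p_gt0 : 0 < p) (Wp : matrix_weight W) (x_neq0 : x != 0).

(** Insert W t ^ (-1/p) W t ^ (1/p) = 1 in front of x. *)
Lemma ae_euclid_norm_le_kernel : {ae mu, forall t,
  0 < euclid_norm (mxpowR (W t) p^-1 *m x) /\
  forall s, euclid_norm (mxpowR (W s) p^-1 *m x) <=
    c * nrm (mxpowR (W s) p^-1 *m mxpowR (W t) (- p^-1)) *
    euclid_norm (mxpowR (W t) p^-1 *m x)}.
Proof.
have [_] := Wp; apply: filterS => t Wt; split.
  exact: euclid_norm_mxpowR_gt0.
move=> s; apply: le_trans (nrm_ge _ _).
rewrite -mulmxA [mxpowR (W t) (- p^-1) *m _]mulmxA (mxpowRN_mul _ Wt).
by rewrite mul1mx.
Qed.

Lemma directional_weight_scalar_weight : scalar_weight (directional_weight p W x).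
Proof.
split; first exact: directional_weight_measurable.
by apply: filterS ae_euclid_norm_le_kernel => t [lt0 _]; exact: powR_gt0.
Qed.

End directional_weights.

Section matrix_Ap_const.
Context {R : realType} {d N : nat}.
Variables (nrm : 'M[R[i]]_N -> R) (p : R) (B : set (set (Rd R d))).
Variable W : Rd R d -> 'M[R[i]]_N.
Hypotheses (p_gt0 : 0 < p) (sB : structured_basis B).
Local Notation K s t := (nrm (mxpowR (W s) p^-1 *m mxpowR (W t) (- p^-1))).
Local Open Scope ereal_scope.

(** An essential supremum over a null set is -oo, hence the use of a set of
    positive measure when p <= 1. *)
Lemma matrix_Ap_const_ge0 : 0 <= matrix_Ap_const nrm p B W.
Proof.
rewrite /matrix_Ap_const; have [E BE E0] := structured_basis_nonnull sB.
have [mE _ _] := sB.1 E BE.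
case: ifPn => _.
  apply: le_trans (ereal_sup_ubound (ex_intro2 _ _ E BE erefl)).
  apply: ess_sup_in_ge0 => // t _; apply: fint_ge0 => s _.
  by rewrite lee_fin powR_ge0.
apply: le_trans (ereal_sup_ubound (ex_intro2 _ _ E BE erefl)).
exact: poweR_ge0.
Qed.

Lemma fint_kernel_le_matrix_Ap_const E (p' := (p / (p - 1))%R) :
  (1 < p)%R -> B E ->
  fint E (fun s => fint E (fun t => (K s t `^ p')%:E) `^ (p / p')) <=
  matrix_Ap_const nrm p B W `^ p.
Proof.
move=> p1 BE; set J := fint E _.
have J0 : 0 <= J by apply: fint_ge0 => s _; exact: poweR_ge0.
have -> : J = (J `^ p^-1) `^ p by rewrite -poweRrM mulVf ?gt_eqF// poweRe1.
have JpA : J `^ p^-1 <= matrix_Ap_const nrm p B W.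
  by rewrite /matrix_Ap_const (lt_geF p1); apply: ereal_sup_ubound; exists E.
apply: gt0_ler_poweR; rewrite ?(ltW p_gt0)// in_itv/= leey andbT.
  exact: poweR_ge0.
exact: matrix_Ap_const_ge0.
Qed.

End matrix_Ap_const.

Theorem lemma2p5 (R : realType) (N : nat) (nrm : 'M[R[i]]_N -> R)
    (nrmP : matrix_norm nrm) (p : R) (p_gt0 : 0 < p) :
  exists c : R, forall (d : nat) (B : set (set (Rd R d)))
      (W : Rd R d -> 'M[R[i]]_N),
    structured_basis B -> matrix_Ap nrm p B W ->
    exists C : R,
      [/\ 1 < p ->
            (C%:E <= c%:E * matrix_Ap_const nrm p B W `^ (p - 1))%E,
          1 < p -> forall x : 'cV[R[i]]_N, x != 0 ->
            scalar_Ap p B (directional_weight p W x) /\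
            (scalar_Ap_const p B (directional_weight p W x) <=
               C%:E * matrix_Ap_const nrm p B W)%E
        & p <= 1 -> euclid_compatible nrm ->
          forall x : 'cV[R[i]]_N, x != 0 ->
            scalar_Ap 1 B (directional_weight p W x) /\
            (scalar_Ap_const 1 B (directional_weight p W x) <=
               matrix_Ap_const nrm p B W)%E].
Proof.
have [c c0 nrm_ge] := euclid_norm_mulmx_le nrmP.
exists (c `^ p) => d B W sB [Wp Aoo].
have A0 := matrix_Ap_const_ge0 nrm p W sB.
set A := matrix_Ap_const nrm p B W in Aoo A0 *.
have Afin : A \is a fin_num by rewrite ge0_fin_numE.
have mB E : B E -> measurable E by case/(sB.1 E).
exists (c `^ p * fine A `^ (p - 1)); split.
- by move=> _; rewrite -[in leRHS](fineK Afin) poweR_EFin EFinM.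
- move=> p1 x x0.
  suff le_A : (scalar_Ap_const p B (directional_weight p W x) <=
               (c `^ p * fine A `^ (p - 1))%:E * A)%E.
    split=> //; split; first exact: directional_weight_scalar_weight nrm_ge _ _ _.
    by rewrite (le_lt_trans le_A)// -(fineK Afin) -EFinM ltry.
  rewrite /scalar_Ap_const gt_eqF//; apply: ge_ereal_sup => _ [E BE <-].
  have := @fint_mul_dual_le_kernel R d p c _ _ E p_gt0 c0 (mB E BE)
    (fun t => euclid_norm_ge0 _) (fun s t => matrix_norm_ge0 nrmP _)
    (directional_weight_measurable x p_gt0 Wp)
    (ae_euclid_norm_le_kernel p nrm_ge Wp x0) p1.
  move=> /le_trans; apply.
  rewrite EFinM -muleA lee_wpmul2l ?lee_fin ?powR_ge0//.
  rewrite (le_trans (fint_kernel_le_matrix_Ap_const nrm W p_gt0 sB p1 BE))//.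
  rewrite -/A -(fineK Afin) poweR_EFin -EFinM lee_fin mulrC.
  by rewrite mulr_powRB1 ?fine_ge0.
- move=> p1 nrm_compat x x0.
  have nrm_ge1 M v : euclid_norm (M *m v) <= 1 * nrm M * euclid_norm v.
    by rewrite mul1r nrm_compat.
  suff le_A : (scalar_Ap_const 1 B (directional_weight p W x) <= A)%E.
    split=> //; split; first exact: directional_weight_scalar_weight nrm_ge _ _ _.
    exact: le_lt_trans Aoo.
  rewrite /scalar_Ap_const eqxx; apply: ge_ereal_sup => _ [E BE <-].
  have [E0|E0] := eqVneq (lebesgue E) 0%E.
    by rewrite {1}/fint E0 /= invr0 !mul0e.
  have := @fint_mul_ess_sup_le_kernel R d p 1 _ _ E p_gt0 ltr01 (mB E BE)
    (fun t => euclid_norm_ge0 _) (fun s t => matrix_norm_ge0 nrmP _)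
    (directional_weight_measurable x p_gt0 Wp)
    (ae_euclid_norm_le_kernel p nrm_ge1 Wp x0) E0.
  move=> /le_trans; apply; rewrite powR1 mul1e.
  by rewrite /A /matrix_Ap_const p1; apply: ereal_sup_ubound; exists E.
Qed.
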